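(* Let $M=\mathbb{R}^6_s/\Gamma$ be a complete homogeneous flat pseudo-Riemannian manifold of dimension $6$ (with $6-s\geq s$), and assume $\Gamma$ is abelian. Then $\Gamma$ is free abelian. Depending on the signature of $M$, we have the following possibilities: (1) Signature $(6,0)$ or $(5,1)$: $\Gamma$ is a group of pure translations. (2) Signature $(4,2)$: $\Gamma$ is either a group of pure translations, or $\Gamma$ contains elements $\gamma=(I+A,v)$ with $A\neq 0$ subject to the following constraints: $\Gamma$ is generated by elements $\gamma_i=(I+A_i,v_i)$, $i=1,\ldots,k$, with linearly independent translation parts $v_1,\ldots,v_k$, which in a Witt basis with respect to the ($2$-dimensional) subspace $U_\Gamma$ have the form $$\gamma_i=\left(\begin{pmatrix} I_2 & 0 & C_i \\ 0 & I_2 & 0 \\ 0 & 0 & I_2 \end{pmatrix},\begin{pmatrix} u_i \\ w_i \\ 0 \end{pmatrix}\right),\qquad C_i=\begin{pmatrix} 0 & c_i \\ -c_i & 0 \end{pmatrix},\quad c_i\in\mathbb{R},\ u_i,w_i\in\mathbb{R}^2,$$ and for all $\lambda_1,\ldots,\lambda_k\in\mathbb{R}$, $\sum_i\lambda_iw_i=0$ implies $\sum_i\lambda_iC_i=0$ (equivalently $\sum_i\lambda_iA_i=0$). Further, $\mathrm{rk}\,\Gamma\leq 4$. (3) Signature $(3,3)$: If $\dim U_\Gamma<3$, then $\Gamma$ is one of the groups that may appear for signature $(4,2)$, as described in (2). There is no abelian $\Gamma$ with $\dim U_\Gamma=3$.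
   Context: $\mathbb{R}^n_s$ denotes $\mathbb{R}^n$ with a non-degenerate symmetric bilinear form $\langle\cdot,\cdot\rangle$ of signature $(n-s,s)$, with $n-s\geq s$, and $\mathrm{Iso}(\mathbb{R}^n_s)$ is its group of (affine) isometries. Affine maps are written $\gamma=(I+A,v)$, with linear part $I+A$ and translation part $v$. ''$M=\mathbb{R}^n_s/\Gamma$ is a complete homogeneous flat pseudo-Riemannian manifold'' means that $\Gamma\subset\mathrm{Iso}(\mathbb{R}^n_s)$ (the fundamental group of $M$) acts freely and properly discontinuously and the isometry group of $M$ acts transitively on $M$ (equivalently, the centralizer of $\Gamma$ in $\mathrm{Iso}(\mathbb{R}^n_s)$ acts transitively on $\mathbb{R}^n_s$). Set $U_\Gamma=\sum_{(I+A,v)\in\Gamma}\mathrm{im}\,A$; it is totally isotropic when the group of linear parts of $\Gamma$ is abelian. For a totally isotropic subspace $U$ of dimension $k$, a Witt basis with respect to $U$ is a basis $u_1,\ldots,u_k,w_1,\ldots,w_{n-2k},u_1^*,\ldots,u_k^*$ of $\mathbb{R}^n_s$ such that $u_1,\dots,u_k$ is a basis of $U$, the $w_j$ form a basis of a non-degenerate subspace $W$ with $U^\perp=U\oplus W$, and $u_1^*,\dots,u_k^*$ is a basis of a totally isotropic subspace $U^*$ orthogonal to $W$ with $\langle u_i,u_j^*\rangle=\delta_{ij}$. *)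

(* Defs.v *)
From HB Require Import structures.
From mathcomp Require Import all_boot all_order all_algebra.
From mathcomp Require Import sesquilinear.
From mathcomp Require Import boolp classical_sets functions cardinality.
From mathcomp Require Import reals topology normedtype.
Set Implicit Arguments.
Unset Strict Implicit.
Unset Printing Implicit Defensive.
Import Order.TTheory GRing.Theory Num.Theory.
Import numFieldTopology.Exports numFieldNormedType.Exports.
Local Open Scope classical_set_scope.
Local Open Scope ring_scope.

Section Subgroups.
Variable G : groupType.
Implicit Types (H S : set G).

Definition subgroup H : Prop := group_closed [in H].

Definition generated S : set G := smallest subgroup S.

Definition abelian_subgroup H : Prop :=
  forall x y, H x -> H y -> commute x y.

Definition zexpg (x : G) (k : int) : G :=
  match k with Posz n => (x ^+ n)%g | Negz n => (x ^- n.+1)%g end.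

(* [S] may be infinite: independence is tested on finite subfamilies. *)
Definition zbasis H S : Prop :=
  [/\ abelian_subgroup H, H = generated S &
    forall n (b : 'I_n -> G) (e : 'I_n -> int),
      injective b -> (forall i, S (b i)) ->
      \big[*%g/1%g]_(i < n) zexpg (b i) (e i) = 1%g -> forall i, e i = 0].

Definition free_abelian H : Prop := exists S, zbasis H S.

Definition has_rank H (r : nat) : Prop :=
  exists2 S, zbasis H S & (S #= `I_r)%card.

End Subgroups.

Section AffineGroup.
Variables (R : comUnitRingType) (n : nat).

(* The invertible affine map x |-> L *m x + v is the pair (L, v). *)
Record affine := Affine {
  affine_pair : 'M[R]_n * 'cV[R]_n;
  _ : affine_pair.1 \in unitmx }.

HB.instance Definition _ := [isSub for affine_pair].
HB.instance Definition _ := [Choice of affine by <:].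

Definition lin (g : affine) : 'M[R]_n := (val g).1.
Definition trl (g : affine) : 'cV[R]_n := (val g).2.
Definition act (g : affine) (x : 'cV[R]_n) : 'cV[R]_n := lin g *m x + trl g.

Lemma lin_unit g : lin g \in unitmx.
Proof. by case: g. Qed.

Lemma affineP f g : lin f = lin g -> trl f = trl g -> f = g.
Proof.
move=> Elin Etrl; apply: val_inj.
by rewrite [val f]surjective_pairing [val g]surjective_pairing; congr pair.
Qed.

Definition affine_one : affine := @Affine (1%:M, 0) (unitmx1 _ _).

Fact affine_mul_unit (f g : affine) : lin f *m lin g \in unitmx.
Proof. by rewrite unitmx_mul !lin_unit. Qed.

Definition affine_mul (f g : affine) : affine :=
  @Affine (lin f *m lin g, lin f *m trl g + trl f) (affine_mul_unit f g).

Fact affine_inv_unit (f : affine) : invmx (lin f) \in unitmx.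
Proof. by rewrite unitmx_inv lin_unit. Qed.

Definition affine_inv (f : affine) : affine :=
  @Affine (invmx (lin f), - (invmx (lin f) *m trl f)) (affine_inv_unit f).

Fact affine_mulA : associative affine_mul.
Proof.
move=> f g h; apply: affineP; rewrite /lin /trl /= ?mulmxA //.
by rewrite mulmxDr mulmxA addrA.
Qed.

Fact affine_mul1 : left_id affine_one affine_mul.
Proof. by move=> f; apply: affineP; rewrite /lin /trl /= !mul1mx ?addr0. Qed.

Fact affine_mulr1 : right_id affine_one affine_mul.
Proof.
by move=> f; apply: affineP; rewrite /lin /trl /= ?mulmx1 ?mulmx0 ?add0r.
Qed.

Fact affine_mulV : left_inverse affine_one affine_inv affine_mul.
Proof.
move=> f; apply: affineP; last by rewrite {1}/trl /= subrr.
by rewrite {1}/lin /= mulVmx ?lin_unit.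
Qed.

Fact affine_mulrV : right_inverse affine_one affine_inv affine_mul.
Proof.
move=> f; apply: affineP; first by rewrite {1}/lin /= mulmxV ?lin_unit.
by rewrite {1}/trl /= mulmxN mulmxA mulmxV ?lin_unit // mul1mx addNr.
Qed.

HB.instance Definition _ := isGroup.Build affine
  affine_mulA affine_mul1 affine_mulr1 affine_mulV affine_mulrV.

Lemma actM f g x : act (f * g)%g x = act f (act g x).
Proof. by rewrite /act mulmxDr mulmxA -addrA. Qed.

End AffineGroup.

Section FlatHomogeneous.
Variables (R : realType) (n : nat).
Implicit Types (B : {symmetric 'cV[R]_n}) (Gamma : set (affine R n)).

(* Signature (p, q): p plus signs, q minus signs; since an orthogonal basis
   consisting of p + q vectors of square +1 or -1 is required, this includes
   non-degeneracy and p + q = n. *)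
Definition has_signature B (p q : nat) : Prop :=
  exists2 e : (p + q).-tuple 'cV[R]_n, basis_of fullv e &
    forall i j, B (tnth e i) (tnth e j) =
      if i == j then (if (i < p)%N then 1 else -1) else 0.

Definition Iso B : set (affine R n) :=
  [set g | isometry B B (mulmx (lin g))].

Definition centralizer_Iso B Gamma : set (affine R n) :=
  [set g | Iso B g /\ forall h, Gamma h -> commute g h].

Definition acts_freely Gamma : Prop :=
  forall g x, Gamma g -> act g x = x -> g = 1%g.

Definition acts_properly_discontinuously Gamma : Prop :=
  forall K : set 'cV[R]_n, compact K ->
    finite_set [set g | Gamma g /\ (act g @` K) `&` K !=set0].

(* [R^n / Gamma] is a complete homogeneous flat pseudo-Riemannian manifold;
   homogeneity of the quotient is transitivity of the centralizer of [Gamma]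
   in the isometry group of R^n. *)
Record homogeneous_flat B Gamma : Prop := HomogeneousFlat {
  _ : Gamma `<=` Iso B;
  _ : subgroup Gamma;
  _ : acts_freely Gamma;
  _ : acts_properly_discontinuously Gamma;
  _ : forall x y, exists2 g, centralizer_Iso B Gamma g & act g x = y }.

Definition pure_translations Gamma : Prop :=
  forall g, Gamma g -> lin g = 1%:M.

Definition imA (g : affine R n) : {vspace 'cV[R]_n} :=
  limg (linfun (mulmx (lin g - 1%:M) : 'cV[R]_n -> 'cV[R]_n)).

Definition sum_imA Gamma : set 'cV[R]_n :=
  [set x | exists m (g : 'I_m -> affine R n),
    (forall i, Gamma (g i)) /\ x \in (\sum_(i < m) imA (g i))%VS].

(* The possibly infinite sum of the [imA g], as a [{vspace _}]; the default
   value of [xget] is never used, see [U_ofP]. *)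
Definition U_of Gamma : {vspace 'cV[R]_n} :=
  xget 0%VS [set V | forall x, x \in V <-> sum_imA Gamma x].

Lemma sum_imA_add Gamma x y :
  sum_imA Gamma x -> sum_imA Gamma y -> sum_imA Gamma (x + y).
Proof.
move=> [m [g [Gg xg]]] [p [h [Gh yh]]].
exists (m + p)%N, (fun i =>
  match fintype.split i with inl j => g j | inr j => h j end).
split=> [i|]; first by case: (fintype.split i).
rewrite big_split_ord /=; apply: memv_add.
  rewrite (eq_bigr (fun i => imA (g i))) // => i _.
  by rewrite (unsplitK (inl i)).
rewrite (eq_bigr (fun i => imA (h i))) // => i _.
by rewrite (unsplitK (inr i)).
Qed.

Lemma sum_imA_scale Gamma a x : sum_imA Gamma x -> sum_imA Gamma (a *: x).
Proof. by move=> [m [g [Gg xg]]]; exists m, g; split=> //; exact: memvZ. Qed.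

Lemma sum_imA0 Gamma : sum_imA Gamma 0.
Proof.
exists 0%N, (fun=> 1%g); split; first by case.
by rewrite mem0v.
Qed.

Lemma U_ofP Gamma x : x \in U_of Gamma <-> sum_imA Gamma x.
Proof.
rewrite /U_of; case: xgetP => [V _ /(_ x)//|noV]; exfalso.
pose P d := `[< exists2 V : {vspace 'cV[R]_n},
  forall y, y \in V -> sum_imA Gamma y & \dim V = d >].
have exP : exists d, P d.
  exists 0%N; apply/asboolP; exists 0%VS; last exact: dimv0.
  by move=> y; rewrite memv0 => /eqP ->; exact: sum_imA0.
have ubP d : P d -> (d <= \dim {: 'cV[R]_n})%N.
  by move=> /asboolP[V _ <-]; apply: dimvS; exact: subvf.
case: (ex_maxnP exP ubP) => d /asboolP[V VG dV] maxd.
apply: (noV V) => y; split; first exact: VG.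
move=> Gy; apply: contrapT => /negP yV.
have : (\dim (V + <[y]>)%VS <= d)%N.
  apply: maxd; apply/asboolP; exists (V + <[y]>)%VS => // z.
  move=> /memv_addP[v vV [w /vlineP[a ->] ->]].
  by apply: sum_imA_add; [exact: VG|exact: sum_imA_scale].
rewrite -dV => ledim.
have /eqP VE : V == (V + <[y]>)%VS by rewrite eqEdim addvSl.
by move: yV; rewrite VE memvE addvSr.
Qed.

Definition witt_basis B (U : {vspace 'cV[R]_n}) k m
    (u : k.-tuple 'cV[R]_n) (w : m.-tuple 'cV[R]_n) (u' : k.-tuple 'cV[R]_n)
    : Prop :=
  let W := <<w>>%VS in let U' := <<u'>>%VS in
  [/\ basis_of fullv (u ++ w ++ u') /\ basis_of U u,
      basis_of W w /\ (W :&: orthov B W = 0)%VS,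
      orthov B U = (U + W)%VS /\ directv (U + W),
      (basis_of U' u' /\ (U' <= orthov B U')%VS) /\ (U' <= orthov B W)%VS &
      forall i j, B (tnth u i) (tnth u' j) = (i == j)%:R].

Definition col_family k (t : k.-tuple 'cV[R]_n) : 'M[R]_(n, k) :=
  \matrix_(i, j) tnth t j i 0.

Definition basis_mx k m (u : k.-tuple 'cV[R]_n) (w : m.-tuple 'cV[R]_n)
    (u' : k.-tuple 'cV[R]_n) : 'M[R]_(n, k + m + k) :=
  row_mx (row_mx (col_family u) (col_family w)) (col_family u').

(* When the columns of P form a basis, this says that [g] has linear part
     ( I 0 C )                          ( a )
     ( 0 I 0 )   and translation part   ( b )
     ( 0 0 I )                          ( 0 )
   with respect to that basis. *)
Definition unipotent_form k m (P : 'M[R]_(n, k + m + k)) (g : affine R n)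
    (C : 'M[R]_k) (a : 'cV[R]_k) (b : 'cV[R]_m) : Prop :=
  lin g *m P =
    P *m block_mx (block_mx 1%:M 0 0 1%:M) (col_mx C 0) 0 1%:M /\
  trl g = P *m col_mx (col_mx a b) 0.

Definition skew2 (c : R) : 'M[R]_2 :=
  \matrix_(i, j) if i == j then 0 else if (i < j)%N then c else - c.

Definition generators_in_form k (gam : 'I_k -> affine R n)
    (P : 'M[R]_(n, 2 + 2 + 2)) : Prop :=
  exists (c : 'I_k -> R) (a b : 'I_k -> 'cV[R]_2),
    (forall i, unipotent_form P (gam i) (skew2 (c i)) (a i) (b i)) /\
    forall lam : 'I_k -> R,
      (\sum_i lam i *: b i = 0 -> \sum_i lam i *: skew2 (c i) = 0) /\
      (\sum_i lam i *: skew2 (c i) = 0 <->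
       \sum_i lam i *: (lin (gam i) - 1%:M) = 0).

(* The generators do not depend on the choice of the Witt basis, and they have
   the normal form in every Witt basis with respect to [U_of Gamma]. *)
Definition nontranslational_42 B Gamma : Prop :=
  [/\ exists2 g, Gamma g & lin g <> 1%:M,
      \dim (U_of Gamma) = 2%N,
      exists k (gam : 'I_k -> affine R n),
        [/\ Gamma = generated (range gam),
            free [tuple trl (gam i) | i < k],
            exists (u w u' : 2.-tuple 'cV[R]_n),
              witt_basis B (U_of Gamma) u w u' &
            forall u w u' : 2.-tuple 'cV[R]_n,
              witt_basis B (U_of Gamma) u w u' ->
              generators_in_form gam (basis_mx u w u')] &
      exists2 r, (r <= 4)%N & has_rank Gamma r].

Definition groups_42 B Gamma : Prop :=
  pure_translations Gamma \/ nontranslational_42 B Gamma.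

End FlatHomogeneous.

(* Main.v *)
(* Write an element of Gamma as (I + A, v).  As the centralizer of Gamma acts
   transitively by isometries, <Ax + v, A'x + v'> does not depend on x; for an
   abelian Gamma this gives AA' = 0 and Av' = 0 for all pairs of elements, with
   A skew.  Hence U_Gamma is totally isotropic and orthogonal to all
   translation parts, and for every x the displacement Ax + v is an injective
   homomorphism from Gamma onto a discrete subgroup of R^n, so that Gamma is
   free abelian and R-linear relations between displacements at x are trivial.
   A skew map has no rank 1, so dim U_Gamma <= 1 forces translations, and when
   dim U_Gamma = 2 the block form is read off any Witt basis; if
   sum l_i w_i = 0 and C := sum l_i C_i <> 0 then C is invertible and the
   displacements satisfy a nontrivial relation at some x in U*.
   If dim U_Gamma = 3 in dimension 6, pick (I + A, v) with A <> 0.  Then v lies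
   in U = U^perp but not in im A, as the action is free, so
   U = im A + <v>.  The linear part L of an element of the centralizer sending
   0 to x satisfies (L - I)U <= im A and (L - I)v' = A'x, whence
   im A' <= im A for all (I + A', v'), and U = im A, a contradiction. *)
From HB Require Import structures.
Require Import Defs.
From mathcomp Require Import all_boot all_order all_algebra.
From mathcomp Require Import sesquilinear.
From mathcomp Require Import mathcomp_extra boolp classical_sets functions cardinality.
From mathcomp Require Import reals topology normedtype.
From mathcomp Require Import zify.
Set Implicit Arguments.
Unset Strict Implicit.
Unset Printing Implicit Defensive.
Import Order.TTheory GRing.Theory Num.Theory.
Import numFieldTopology.Exports numFieldNormedType.Exports.
Local Open Scope classical_set_scope.
Local Open Scope ring_scope.

(** * Discrete subgroups of R^n *)

Section Lattice.
Context {R : realType} {n : nat}.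
Implicit Types (T : set 'cV[R]_n) (x : 'cV[R]_n).

Definition zspan {k} (c : 'I_k -> 'cV[R]_n) : set 'cV[R]_n :=
  [set x | exists m : 'I_k -> int, x = \sum_i (m i)%:~R *: c i].

Definition locally_finite T : Prop :=
  forall M : R, finite_set [set x | T x /\ `|x| <= M].

Definition additive_subgroup T : Prop :=
  T 0 /\ forall x y, T x -> T y -> T (x - y).

Lemma additive_subgroupD T x y :
  additive_subgroup T -> T x -> T y -> T (x + y).
Proof.
move=> [T0 TB] Tx Ty; rewrite -[y]opprK; apply: (TB) => //.
by rewrite -[- y]add0r; apply: (TB).
Qed.

Lemma additive_subgroupMz T x (m : int) :
  additive_subgroup T -> T x -> T (m%:~R *: x).
Proof.
move=> GT Tx; have [T0 TB] := GT.
have Tn (p : nat) : T (p%:R *: x).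
  elim: p => [|p IH]; first by rewrite scale0r.
  by rewrite -natr1 scalerDl scale1r; exact: additive_subgroupD.
case: (intP m) => [|p|p]; first by rewrite scale0r.
  exact: Tn.
by rewrite mulrNz scaleNr -[- _]add0r; apply: (TB) => //; exact: Tn.
Qed.

Lemma additive_subgroup_zspan T k (c : 'I_k -> 'cV[R]_n) :
  additive_subgroup T -> (forall i, T (c i)) -> zspan c `<=` T.
Proof.
move=> GT Tc x [m ->]; elim/big_ind: _ => [|y z|i _].
- by case: GT.
- exact: additive_subgroupD.
- exact: additive_subgroupMz.
Qed.

Lemma finite_argmin {I : eqType} (F : set I) (f : I -> R) (x0 : I) :
  finite_set F -> F x0 -> exists2 x, F x & forall y, F y -> f x <= f y.
Proof.
move=> /finite_seqP[s ->]; elim: s x0 => [//|a s IH] x0 _.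
case: s IH => [_|b s /(_ b (mem_head _ _))[x /= xs xmin]].
  by exists a => [|y]; rewrite /= inE // => /eqP ->.
have [le_ax|/ltW le_xa] := leP (f a) (f x).
  exists a => [|y]; rewrite /= inE ?eqxx // => /orP[/eqP -> //|ys].
  exact: le_trans le_ax (xmin y ys).
by exists x => [|y]; rewrite /= inE ?xs ?orbT // => /orP[/eqP -> //|/xmin].
Qed.

(* Induction on the dimension: a basis of the lattice [T] cuts out on the
   hyperplane [<<b'>>] is completed by a short vector of [T] whose coordinate
   along [b0] is positive and minimal. *)
Lemma lattice_basis_span k (b : k.-tuple 'cV[R]_n) T :
  additive_subgroup T -> locally_finite T -> free b ->
  (forall i, T (tnth b i)) -> (forall x, T x -> x \in <<b>>%VS) ->
  exists2 c : k.-tuple 'cV[R]_n, free c & T = zspan (tnth c).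
Proof.
elim: k b T => [|k IH] b T GT FT fb Tb Tsp.
  exists [tuple]; first exact: nil_free.
  apply/seteqP; split=> x; last first.
    by move=> [m ->]; rewrite big_ord0; case: GT.
  move/Tsp; rewrite tuple0 span_nil memv0 => /eqP ->.
  by exists (fun=> 0); rewrite big_ord0.
case/tupleP: b fb Tb Tsp => b0 b' fb Tb Tsp.
have Tb0 : T b0 by have := Tb ord0; rewrite tnth0.
have fb' : free b' by move: fb; rewrite free_cons => /andP[].
have GT' : additive_subgroup [set x | T x /\ x \in <<b'>>%VS].
  case: GT => T0 TB; split=> [|x y [Tx xb] [Ty yb]] /=.
    by rewrite mem0v.
  by split; [exact: TB|exact: memvB].
have [||x [] //|c fc Tc] := IH b' _ GT' _ fb'.
- by move=> M; apply: sub_finite_set (FT M) => x /= [[Tx _] xM].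
- move=> i; split; last by rewrite memv_span ?mem_tnth.
  by have := Tb (lift ord0 i); rewrite tnthS.
have cT i : T (tnth c i) /\ tnth c i \in <<b'>>%VS.
  suff : zspan (tnth c) (tnth c i) by rewrite -Tc.
  exists (fun j => (j == i)%:R); rewrite (bigD1 i) //= eqxx scale1r big1 ?addr0//.
  by move=> j /negPf ->; rewrite scale0r.
have spc : (<<c>> = <<b'>>)%VS.
  apply/eqP; rewrite eqEsubv; apply/andP; split; apply/span_subvP => x.
    by move=> /tnthP[i ->]; case: (cT i).
  move=> /tnthP[i ->].
  have : zspan (tnth c) (tnth b' i).
    rewrite -Tc; split; last by rewrite memv_span ?mem_tnth.
    by have := Tb (lift ord0 i); rewrite tnthS.
  by move=> [m ->]; apply: memv_suml => j _; rewrite memvZ ?memv_span ?mem_tnth.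
(* [h] is the coordinate along [b0]; it vanishes on [<<b'>>]. *)
pose h x : R := coord [tuple of b0 :: b'] ord0 x.
have hD u v : h (u + v) = h u + h v by rewrite /h linearD.
have hB u v : h (u - v) = h u - h v by rewrite /h linearB.
have hZ a u : h (a *: u) = a * h u by rewrite /h linearZ.
have hb0 : h b0 = 1 by exact: (@coord_free _ _ _ [tuple of b0 :: b'] ord0 ord0 fb).
have hb' x : x \in <<b'>>%VS -> h x = 0.
  move/coord_span ->; rewrite /h linear_sum big1 // => i _.
  by rewrite linearZ /= (_ : b'`_i = [tuple of b0 :: b']`_(lift ord0 i)) //
    coord_free // mulr0.
have hP x : T x -> x - h x *: b0 \in <<b'>>%VS.
  move/Tsp; rewrite span_cons => /memv_addP[_ /vlineP[s ->] [w wb ->]].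
  by rewrite hD hZ hb0 (hb' w wb) mulr1 addr0 addrAC subrr add0r.
(* [M] bounds every vector whose coefficients along [b0] and the [c_i] lie in [0, 1]. Reduction
   modulo the [c_i] therefore brings the small vectors of [T] into a finite set. *)
pose M := `|b0| + \sum_i `|tnth c i|.
pose F := [set x | (T x /\ `|x| <= M) /\ 0 < h x].
have [||y [[Ty _] hy0] ymin] := @finite_argmin _ F h b0.
- by apply: sub_finite_set (FT M) => x [].
- by split; [split=> //; rewrite lerDl sumr_ge0|rewrite hb0].
exists [tuple of y :: c].
  rewrite /= free_cons fc andbT spc; apply/negP => /hb' E.
  by move: hy0; rewrite E ltxx.
apply/seteqP; split=> x; last first.
  apply: additive_subgroup_zspan => // i.
  by case: (unliftP ord0 i) => [j|] ->; rewrite ?tnthS ?tnth0 //; case: (cT j).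
move=> Tx.
(* Euclidean division of [h x] by [h y]; it remains to see that the remainder [z] has [h z = 0]. *)
pose q := Num.floor (h x / h y).
have Tz : T (x - q%:~R *: y) by case: (GT) => _; apply => //; exact: additive_subgroupMz.
set z := x - _ in Tz.
have hz : 0 <= h z < h y.
  rewrite hB hZ subr_ge0 -ler_pdivlMr // floor_le /=.
  by rewrite ltrBlDr -{1}[h y]mul1r -mulrDl -ltr_pdivrMr // addrC -intrD1 floorD1_gt.
have zb : z \in <<b'>>%VS.
  have := hP _ Tz; rewrite -{1}spc => /coord_span.
  set t := fun i => coord c i (z - h z *: b0) => zE.
  pose w := \sum_i (Num.floor (t i))%:~R *: tnth c i.
  have Tw : T w.
    apply: (additive_subgroup_zspan GT (c := tnth c)) => [i|]; last first.
      by exists (fun i => Num.floor (t i)).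
    by case: (cT i).
  have wb : w \in <<b'>>%VS.
    by apply: memv_suml => i _; apply: memvZ; case: (cT i).
  have hzw : h (z - w) = h z by rewrite hB (hb' w wb) subr0.
  have zwM : `|z - w| <= M.
    have -> : z - w = h z *: b0 + \sum_i (t i - (Num.floor (t i))%:~R) *: tnth c i.
      under eq_bigr do rewrite scalerBl.
      rewrite sumrB addrA; congr (_ - _); apply/eqP.
      rewrite addrC -subr_eq zE; apply/eqP; apply: eq_bigr => i _.
      by rewrite -tnth_nth.
    apply: le_trans (ler_normD _ _) _; apply: lerD.
      have /andP[hz0 /ltW hz1] := hz; rewrite normrZ ger0_norm // ler_piMl //.
      by apply: le_trans hz1 _; rewrite -hb0; apply: ymin; split;
        [split=> //; rewrite lerDl sumr_ge0|rewrite hb0].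
    apply: le_trans (ler_norm_sum _ _ _) _; apply: ler_sum => i _.
    rewrite normrZ ler_piMl // ger0_norm ?subr_ge0 ?floor_le //.
    by rewrite lerBlDl -intrD1 ltW // floorD1_gt.
  (* If [h z] were positive, [z - w] would lie in [F] with a value of [h] below the minimum
     [h y]. *)
  have [hz0|hz0] := ltrP 0 (h z).
    have : h y <= h (z - w).
      by apply: ymin; split; [split=> //; case: (GT) => _; apply|rewrite hzw].
    by rewrite hzw leNgt; case/andP: hz => _ ->.
  have hz00 : h z = 0 by apply/eqP; rewrite eq_le hz0; case/andP: hz.
  by have := hP _ Tz; rewrite hz00 scale0r subr0.
have [m zE] : zspan (tnth c) z by rewrite -Tc.
exists (fun i => if unlift ord0 i is Some j then m j else q).
rewrite big_ord_recl unlift_none tnth0 -[x](subrK (q%:~R *: y)) -/z addrC zE.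
by congr (_ + _); apply: eq_bigr => i _; rewrite liftK tnthS.
Qed.

(** A free family of maximal length inside [T] spans a subspace containing [T], so
    [lattice_basis_span] applies to it. *)
Lemma lattice_basis T : additive_subgroup T -> locally_finite T ->
  exists k (c : k.-tuple 'cV[R]_n), free c /\ T = zspan (tnth c).
Proof.
move=> GT FT.
pose P k := `[< exists2 b : k.-tuple 'cV[R]_n, free b & forall i, T (tnth b i) >].
have exP : exists k, P k.
  by exists 0%N; apply/asboolP; exists [tuple]; [exact: nil_free|case].
have ubP k : P k -> (k <= \dim {: 'cV[R]_n})%N.
  move=> /asboolP[b fb _].
  by rewrite -(size_tuple b) -(eqnP fb) dimvS ?subvf.
case: (ex_maxnP exP ubP) => k /asboolP[b fb Tb] maxk.
have [|c fc Tc] := lattice_basis_span GT FT fb Tb; last by exists k, c.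
move=> x Tx; apply/negPn/negP => xb.
suff /maxk : P k.+1 by rewrite ltnn.
apply/asboolP; exists [tuple of x :: b]; first by rewrite /= free_cons xb.
by move=> i; case: (unliftP ord0 i) => [j|] ->; rewrite ?tnthS ?tnth0.
Qed.

End Lattice.

(** * Compactness of balls of column vectors *)

Section ClosedBall.
Context {R : realType}.

Lemma le_mx_norm_trmx m n (x : 'M[R]_(m, n)) : `|x^T| <= `|x|.
Proof.
rewrite [leLHS]/Num.norm /= mx_normrE; apply/bigmax_leP; split=> // -[i j] _ /=.
rewrite mxE [leRHS]/Num.norm /= mx_normrE.
by apply/bigmax_geP; right; exists (j, i).
Qed.

(** Heine-Borel for row vectors, carried over by transposition, which preserves the sup norm. *)
Lemma compact_cV_ball n (M : R) : compact [set x : 'cV[R]_n | `|x| <= M].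
Proof.
have normT m p (x : 'M[R]_(m, p)) : `|x^T| = `|x|.
  by apply/eqP; rewrite eq_le le_mx_norm_trmx -{1}[x]trmxK le_mx_norm_trmx.
rewrite (_ : mkset _ = trmx @` [set x : 'rV[R]_n | `|x| <= M]); last first.
  apply/seteqP; split=> [x /= xM|_ [x /= xM <-] /=]; last by rewrite normT.
  by exists x^T; rewrite ?trmxK //= normT.
apply: continuous_compact.
  apply: continuous_subspaceT => x; apply/(cvgrPdist_lt (FF := nbhs_filter x)) => e e0.
  apply: filterS (nbhsx_ballx x e e0) => y.
  by rewrite -ball_normE /= -linearB normT.
apply: bounded_closed_compact.
  exists M; split; first exact: num_real.
  by move=> N MN x /= /le_trans; apply; exact: ltW.
apply: (@closed_comp _ _ (fun x : 'rV[R]_n => `|x|) [set r | r <= M]).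
  by move=> x _; exact: norm_continuous.
exact: closed_le.
Qed.

End ClosedBall.

(** * Nondegenerate symmetric forms *)

Section SymmetricForm.
Context {F : fieldType} {vT : vectType F} (B : {symmetric vT}).

Lemma symC x y : B x y = B y x.
Proof. by rewrite hermC expr0 mul1r. Qed.

Lemma symBl x y z : B (x - y) z = B x z - B y z.
Proof. exact: linearBl. Qed.

Lemma symBr x y z : B x (y - z) = B x y - B x z.
Proof. exact: linearBr. Qed.

Lemma symDl x y z : B (x + y) z = B x z + B y z.
Proof. exact: linearDl. Qed.

Lemma symDr x y z : B x (y + z) = B x y + B x z.
Proof. exact: linearDr. Qed.

Lemma symZl a x y : B (a *: x) y = a * B x y.
Proof. exact: linearZl_LR. Qed.

Lemma symZr a x y : B x (a *: y) = a * B x y.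
Proof. exact: linearZr_LR. Qed.

Lemma sym_suml k (x : 'I_k -> vT) y : B (\sum_i x i) y = \sum_i B (x i) y.
Proof. exact: linear_sumlz. Qed.

Lemma sym_sumr k x (y : 'I_k -> vT) : B x (\sum_i y i) = \sum_i B x (y i).
Proof. exact: linear_sumr. Qed.

Hypothesis Bnd : forall x, (forall y, B x y = 0) -> x = 0.

(** Nondegeneracy makes [x |-> B x] injective into the dual space, hence bijective by dimension. The
    dual family consists of the preimages of the coordinate forms of [u]. *)
Lemma dual_family k (u : k.-tuple vT) : free u ->
  exists x : k.-tuple vT, forall i j, B (tnth u i) (tnth x j) = (i == j)%:R.
Proof.
move=> fu.
pose f (x : vT) : 'Hom(vT, F^o) := linfun (B x : vT -> F^o).
have fE x y : f x y = B x y by rewrite lfunE.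
have f_lin : linear f.
  move=> a x y; apply/lfunP => z.
  by rewrite add_lfunE scale_lfunE !fE symDl symZl.
pose fL := GRing.isLinear.Build F vT 'Hom(vT, F^o) _ f f_lin.
pose g : {linear vT -> 'Hom(vT, F^o)} := HB.pack f fL.
have g0 : lker (linfun g) == 0%VS.
  apply/lker0P => x y; rewrite !lfunE => E; apply/eqP; rewrite -subr_eq0.
  apply/eqP/Bnd => z; rewrite symBl -!fE.
  by rewrite (_ : f x = f y) ?subrr.
have gT : limg (linfun g) = fullv.
  apply/eqP; rewrite eqEdim subvf /= limg_dim_eq; last first.
    by rewrite (eqP g0) capv0.
  by rewrite !dimvf /dim /= muln1.
pose cf i : 'Hom(vT, F^o) := linfun (coord u i : vT -> F^o).
have cfP i : exists x, f x = cf i.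
  have : cf i \in limg (linfun g) by rewrite gT memvf.
  by case/memv_imgP => x _ E; exists x; rewrite E lfunE.
have [x xP] := fin_all_exists cfP.
exists [tuple x i | i < k] => i j.
rewrite tnth_mktuple symC -fE xP lfunE /=.
by rewrite (tnth_nth 0) coord_free // eq_sym.
Qed.

(** A family [x] dual to a basis [u] of [U] spans a complement of the orthogonal of [U]: subtracting
    [\sum_j B u_j y *: x_j] from [y] makes it orthogonal to [U]. *)
Lemma dim_orthov (U : {vspace vT}) :
  (\dim (orthov B U) + \dim U = \dim {: vT})%N.
Proof.
have [x ux] := dual_family (basis_free (vbasisP U)).
set u := vbasis U in ux.
have uU i : tnth u i \in U by apply: vbasis_mem; exact: mem_tnth.
have Bux (t : 'I_(\dim U) -> F) i : B (tnth u i) (\sum_j t j *: tnth x j) = t i.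
  rewrite sym_sumr (bigD1 i) //= symZr ux eqxx mulr1 big1 ?addr0 //.
  by move=> j ij; rewrite symZr ux eq_sym (negPf ij) mulr0.
have fx : free x.
  apply/freeP => t t0 i; rewrite -(Bux t i).
  under eq_bigr do rewrite (tnth_nth 0).
  by rewrite t0 linear0r.
have <- : \dim <<x>>%VS = \dim U by rewrite (eqnP fx) size_tuple.
rewrite -dimv_disjoint_sum.
  congr (\dim _); apply/eqP; rewrite eqEsubv subvf; apply/subvP => y _.
  pose z := \sum_j B (tnth u j) y *: tnth x j.
  rewrite -[y](subrK z); apply: memv_add; last first.
    by apply: memv_suml => j _; rewrite memvZ // memv_span ?mem_tnth.
  have uz i : B (tnth u i) (y - z) = 0 by rewrite symBr Bux subrr.
  apply/mem_orthovP => v /coord_vbasis ->; rewrite sym_sumr big1 // => i _.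
  by rewrite symZr symC -tnth_nth uz mulr0.
apply/eqP; rewrite -subv0; apply/subvP => y /memv_capP[/mem_orthovP yU /coord_span yE].
rewrite memv0 yE big1 // => j _; rewrite -(Bux (fun j => coord x j y) j).
under eq_bigr do rewrite (tnth_nth 0).
by rewrite -yE symC yU ?scale0r.
Qed.

Lemma orthovK (U : {vspace vT}) : orthov B (orthov B U) = U.
Proof.
apply/esym/eqP; rewrite eqEdim orthov_sym subvv /=.
have := dim_orthov (orthov B U); rewrite -(dim_orthov U) addnC => /addnI ->.
by [].
Qed.

Lemma orthov_direct (H : {vspace vT}) : (H :&: orthov B H = 0)%VS ->
  (H + orthov B H = fullv)%VS.
Proof.
move=> H0; apply/eqP; rewrite eqEdim subvf /= dimv_disjoint_sum //.
by rewrite addnC dim_orthov.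
Qed.

(** If [A z] is a nonzero multiple of [a], then [B (A z) z = 0] gives [B a z = 0]. When [A x] is
    nonzero, each [z] in the kernel is [(z - x) + x] with both terms outside the kernel, so [a] is
    orthogonal to everything. *)
Lemma skew_rank_neq1 (A : {linear vT -> vT}) a :
  (forall x, B (A x) x = 0) -> a != 0 -> (forall x, A x \in <[a]>%VS) ->
  forall x, A x = 0.
Proof.
move=> skA a0 Aa x; apply/eqP/negPn/negP => Ax0.
have /vlineP[c cE] := Aa x.
have c0 : c != 0 by apply: contraNneq Ax0 => c0; rewrite cE c0 scale0r.
have Aaz z : A z != 0 -> B a z = 0.
  have /vlineP[d dE] := Aa z => Az0; have d0 : d != 0.
    by apply: contraNneq Az0 => d0; rewrite dE d0 scale0r.
  by have /eqP := skA z; rewrite dE symZl mulf_eq0 (negPf d0) => /eqP.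
case/eqP: a0; apply: Bnd => z; have [Az0|/Aaz //] := eqVneq (A z) 0.
have : B a (z - x) = 0 by apply: Aaz; rewrite linearB Az0 sub0r oppr_eq0.
by rewrite symBr (Aaz x Ax0) subr0.
Qed.

End SymmetricForm.

(** * Signature and the dimension of isotropic subspaces *)

Section Signature.
Context {R : realType} {n : nat} (B : {symmetric 'cV[R]_n}).
Variables p q : nat.
Hypothesis Bpq : has_signature B p q.

Lemma has_signature_dim : (p + q)%N = n.
Proof.
case: Bpq => e be _; have := size_basis be.
by rewrite dimvf /dim /= muln1.
Qed.

Lemma has_signature_nondegenerate x : (forall y, B x y = 0) -> x = 0.
Proof.
case: Bpq => e be eB x0.
rewrite (coord_basis be (memvf x)) big1 // => i _.
suff -> : coord e i x = 0 by rewrite scale0r.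
have := x0 (tnth e i); rewrite {1}(coord_basis be (memvf x)) sym_suml.
rewrite (bigD1 i) //= symZl -tnth_nth eB eqxx big1 => [|j ij]; last first.
  by rewrite symZl -tnth_nth eB (negPf ij) mulr0.
rewrite addr0; case: ifP => _; first by rewrite mulr1.
by move/eqP; rewrite mulrN1 oppr_eq0 => /eqP.
Qed.

(* A totally isotropic subspace meets the positive definite span of the first
   [p] vectors of the orthogonal basis trivially. *)
Lemma has_signature_isotropic (U : {vspace 'cV[R]_n}) :
  (U <= orthov B U)%VS -> (\dim U <= q)%N.
Proof.
move=> UU; case: Bpq => e be eB.
pose f := [tuple tnth e (lshift q i) | i < p]; pose P := <<f>>%VS.
have fP : free f.
  apply/freeP => t t0 i.
  have /freeP fe := basis_free be.
  (* Extension of the coefficients by zero to the whole orthogonal basis. *)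
  pose t' (j : 'I_(p + q)) := if fintype.split j is inl j then t j else 0.
  have := fe t'; rewrite big_split_ord /= [X in _ + X]big1 => [|j _]; last first.
    by rewrite /t' (unsplitK (inr j)) scale0r.
  rewrite addr0 (eq_bigr (fun j => t j *: f`_j)) => [|j _].
    by move=> /(_ t0 (lshift q i)); rewrite /t' (unsplitK (inl i)).
  by rewrite -tnth_nth tnth_mktuple (tnth_nth 0) /t' (unsplitK (inl j)).
have UP0 : (U :&: P = 0)%VS.
  apply/eqP; rewrite -subv0; apply/subvP => x /memv_capP[xU /coord_span].
  pose t i := coord f i x; move=> xE.
  have {}xE : x = \sum_i t i *: tnth f i.
    by rewrite {1}xE; apply: eq_bigr => i _; rewrite -tnth_nth.
  have : B x x = 0 by move/orthovP: UU; apply.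
  have Bx : B x x = \sum_i t i ^+ 2.
    rewrite {1}xE sym_suml; apply: eq_bigr => i _.
    rewrite symZl expr2 tnth_mktuple; congr (_ * _).
    rewrite xE sym_sumr (bigD1 i) //= symZr tnth_mktuple eB eqxx /= ltn_ord.
    rewrite mulr1 big1 ?addr0 // => j ij.
    by rewrite symZr tnth_mktuple eB (inj_eq (@lshift_inj _ _)) eq_sym
      (negPf ij) mulr0.
  rewrite Bx => /psumr_eq0P t0; rewrite memv0 xE big1 // => i _.
  have /eqP := t0 (fun i _ => sqr_ge0 (t i)) i isT.
  by rewrite sqrf_eq0 => /eqP ->; rewrite scale0r.
have := dimvS (subvf (U + P)); rewrite dimv_disjoint_sum // (eqnP fP) size_tuple.
by rewrite dimvf /dim /= muln1 -[X in (_ <= X)%N]has_signature_dim addnC leq_add2l.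
Qed.

End Signature.

(** [U] and an isotropic dual family span a nondegenerate space [H]; any basis of the orthogonal of
    [H] serves as [w]. *)
Lemma witt_basis_exists (R : realType) n (B : {symmetric 'cV[R]_n})
    (U : {vspace 'cV[R]_n}) k m :
  (forall x, (forall y, B x y = 0) -> x = 0) -> (U <= orthov B U)%VS ->
  \dim U = k -> (k + m + k)%N = n ->
  exists (u : k.-tuple 'cV[R]_n) (w : m.-tuple 'cV[R]_n) (u' : k.-tuple 'cV[R]_n),
    witt_basis B U u w u'.
Proof.
move=> Bnd UU dU kmn.
have [u bu] : exists u : k.-tuple 'cV[R]_n, basis_of U u.
  by rewrite -dU; exists (vbasis U); exact: vbasisP.
have [x ux] := dual_family Bnd (basis_free bu).
have uU i : tnth u i \in U by apply: basis_mem bu _; exact: mem_tnth.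
have Buu v w : v \in U -> w \in U -> B v w = 0 by move: UU => /orthovP; apply.
(* Subtracting half of the Gram matrix makes the dual family isotropic. *)
pose u' := [tuple tnth x j - 2^-1 *: \sum_i B (tnth x i) (tnth x j) *: tnth u i | j < k].
have uu' i j : B (tnth u i) (tnth u' j) = (i == j)%:R.
  rewrite tnth_mktuple symBr ux symZr sym_sumr big1 ?mulr0 ?subr0 // => l _.
  by rewrite symZr (Buu _ _ (uU i) (uU l)) mulr0.
have u'u' i j : B (tnth u' i) (tnth u' j) = 0.
  rewrite [tnth u' i]tnth_mktuple symBl symZl sym_suml.
  rewrite [X in _ - _ * X](bigD1 j) //= symZl uu' eqxx mulr1.
  rewrite [X in _ - _ * (_ + X)]big1 => [|l lj]; last first.
    by rewrite symZl uu' (negPf lj) mulr0.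
  rewrite addr0 tnth_mktuple symBr symZr sym_sumr (bigD1 i) //= symZr.
  rewrite [B (tnth x i) (tnth u i)]symC ux eqxx mulr1 big1 => [|l li]; last first.
    by rewrite symZr symC ux (negPf li) mulr0.
  rewrite addr0 (symC _ (tnth x j)) -addrA -opprD -mulrDr -mulr2n.
  by rewrite -[B _ _ *+ 2]mulr_natl mulrA mulVf ?mul1r ?subrr // pnatr_eq0.
have u'B t j : B (tnth u j) (\sum_i t i *: tnth u' i) = t j.
  rewrite sym_sumr (bigD1 j) //= symZr uu' eqxx mulr1 big1 ?addr0 // => i ij.
  by rewrite symZr uu' eq_sym (negPf ij) mulr0.
have uB t j : B (\sum_i t i *: tnth u i) (tnth u' j) = t j.
  rewrite sym_suml (bigD1 j) //= symZl uu' eqxx mulr1 big1 ?addr0 // => i ij.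
  by rewrite symZl uu' (negPf ij) mulr0.
have fu' : free u'.
  apply/freeP => t t0 j; rewrite -(u'B t j).
  under eq_bigr do rewrite (tnth_nth 0).
  by rewrite t0 linear0r.
have uspan y : y \in U -> y = \sum_i coord u i y *: tnth u i.
  move=> yU; rewrite {1}(coord_basis bu yU); apply: eq_bigr => i _.
  by rewrite -tnth_nth.
have u'span y : y \in <<u'>>%VS -> y = \sum_i coord u' i y *: tnth u' i.
  move=> yU; rewrite {1}(coord_span yU); apply: eq_bigr => i _.
  by rewrite -tnth_nth.
have U'U' : (<<u'>> <= orthov B <<u'>>)%VS.
  apply/orthovP => y z /u'span -> /u'span ->.
  rewrite sym_suml big1 // => i _; rewrite symZl sym_sumr big1 ?mulr0 // => j _.
  by rewrite symZr u'u' mulr0.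
pose H := (U + <<u'>>)%VS.
(* For [a + b] in the radical of [H], pairing with the [u_j] kills the coordinates of [b], then
   pairing with the [u'_j] those of [a]. *)
have HH0 : (H :&: orthov B H = 0)%VS.
  apply/eqP; rewrite -subv0; apply/subvP => y /memv_capP[].
  case/memv_addP => a aU [b bU' ->] /mem_orthovP abH.
  have b0 : b = 0.
    rewrite (u'span b bU') big1 // => j _; rewrite -(u'B (fun j => coord u' j b) j).
    rewrite -(u'span b bU') symC -[B b _]add0r -(Buu a (tnth u j) aU (uU j)) -symDl.
    by rewrite abH ?scale0r // memvE (subv_trans _ (addvSl _ _)) // -memvE.
  rewrite b0 addr0 memv0 (uspan a aU) big1 // => j _.
  rewrite -(uB (fun j => coord u j a) j) -(uspan a aU) -[a]addr0 -b0 abH ?scale0r //.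
  by rewrite memvE (subv_trans _ (addvSr _ _)) // -memvE memv_span ?mem_tnth.
have UH : (U <= H)%VS by exact: addvSl.
have U'H : (<<u'>> <= H)%VS by exact: addvSr.
have UU'0 : (U :&: <<u'>> = 0)%VS.
  apply/eqP; rewrite -subv0 -HH0; apply/subvP => y /memv_capP[yU yU'].
  apply/memv_capP; split; first by apply: subvP yU.
  apply/mem_orthovP => _ /memv_addP[a aU [b bU' ->]].
  by rewrite symDr (Buu y a) // add0r; move/orthovP: U'U'; apply.
have dH : \dim H = (k + k)%N.
  by rewrite dimv_disjoint_sum // dU (eqnP fu') size_tuple.
have dfull : \dim {: 'cV[R]_n} = n by rewrite dimvf /dim /= muln1.
have dW : \dim (orthov B H) = m.
  apply/eqP; rewrite -(eqn_add2r (k + k)) -{1}dH dim_orthov // dfull -kmn.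
  by rewrite addnAC addnC.
have [w bw] : exists w : m.-tuple 'cV[R]_n, basis_of (orthov B H) w.
  by rewrite -dW; exists (vbasis (orthov B H)); exact: vbasisP.
have spw : <<w>>%VS = orthov B H by exact: span_basis bw.
have UW : directv (U + <<w>>).
  by apply/directv_addP/eqP; rewrite spw -subv0 -HH0 capvS.
exists u, w, u'; split => //.
- split=> //; rewrite basisEdim !size_cat !size_tuple dfull addnA kmn leqnn andbT.
  rewrite -(orthov_direct Bnd HH0) !span_cat spw (span_basis bu).
  by rewrite (addvC (orthov B H)) addvA subvv.
- split; first by rewrite spw.
  by rewrite spw orthovK // capvC.
(* [U + W] is orthogonal to [U], and both sides have dimension [k + m = n - k]. *)
- split=> //; apply/eqP; rewrite eq_sym eqEdim subv_add UU spw /=.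
  apply/andP; split.
    by rewrite orthov_sym (subv_trans UH) // orthov_sym.
  rewrite -spw (directvP UW) /= spw dU dW -(leq_add2r k).
  by rewrite -{1}dU dim_orthov // dfull kmn.
- split; last by rewrite spw orthovK.
  by split=> //; rewrite /basis_of eqxx.
Qed.

(** * The group Gamma *)

Section Group.
Context {R : realType} {n : nat} {B : {symmetric 'cV[R]_n}}.
Context {Gamma : set (affine R n)}.
Hypothesis Bnd : forall x, (forall y, B x y = 0) -> x = 0.
Hypothesis hM : homogeneous_flat B Gamma.
Hypothesis hab : abelian_subgroup Gamma.
Implicit Types (g h : affine R n) (x y : 'cV[R]_n).

Local Notation A g := (lin g - 1%:M).
Local Notation disp g x := (act g x - x).

Lemma linE g x : lin g *m x = x + A g *m x.
Proof. by rewrite mulmxBl mul1mx addrC subrK. Qed.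

Lemma dispE g x : disp g x = A g *m x + trl g.
Proof. by rewrite /act linE addrAC [x + _]addrC addrK. Qed.

Lemma Gamma1 : Gamma 1%g.
Proof. by case: hM => _ [+ _] _ _ _; rewrite inE. Qed.

Lemma Gamma_div g h : Gamma g -> Gamma h -> Gamma (g / h)%g.
Proof.
case: hM => _ [_ +] _ _ _ => /(_ g h) H Gg Gh.
by have := H; rewrite !inE; apply.
Qed.

Lemma GammaM g h : Gamma g -> Gamma h -> Gamma (g * h)%g.
Proof.
move=> Gg Gh; rewrite -[h]invgK; apply: Gamma_div => //.
by rewrite -[(h^-1)%g]mul1g; apply: Gamma_div => //; exact: Gamma1.
Qed.

(** [L] is the linear part of a centralizing isometry that sends 0 to [x], so its translation part
    is [x]; the two equations are the components of the commutation with [h]. *)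
Lemma centralizer_transitive x : exists L : 'M[R]_n,
  [/\ isometry B B (mulmx L),
      forall h, Gamma h -> L *m A h = A h *m L &
      forall h, Gamma h -> L *m trl h = trl h + A h *m x].
Proof.
case: hM => _ _ _ _ /(_ 0 x)[z [zI zC] zx].
have Ez : trl z = x by move: zx; rewrite /act mulmx0 add0r.
exists (lin z); split=> // h /zC; move/(congr1 val) => [El Et].
  by rewrite mulmxBr mulmxBl mulmx1 mul1mx -/(lin z) -/(lin h) El.
move: Et; rewrite -/(trl z) -/(trl h) -/(lin z) -/(lin h) Ez [lin h *m x]linE.
by rewrite -addrA [x + _]addrC => /addIr ->; rewrite addrC.
Qed.

(** By the last clause of [centralizer_transitive], [L] maps translation parts to displacements at
    [x], and [L] preserves [B]. *)
Lemma disp_form g h x : Gamma g -> Gamma h ->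
  B (disp g x) (disp h x) = B (trl g) (trl h).
Proof.
move=> Gg Gh; have [L [LI _ Lt]] := centralizer_transitive x.
by rewrite !dispE ![_ *m x + _]addrC -!Lt // (LI _ _).
Qed.

(** The constant in [disp_form] expands into an even (quadratic) and an odd (linear) part in [x];
    comparing [x] with [- x] makes both vanish. *)
Lemma disp_formP g h x : Gamma g -> Gamma h ->
  B (A g *m x) (A h *m x) = 0 /\ B (A g *m x) (trl h) + B (trl g) (A h *m x) = 0.
Proof.
move=> Gg Gh.
have E y : B (A g *m y) (A h *m y) + (B (A g *m y) (trl h) + B (trl g) (A h *m y)) = 0.
  have := disp_form y Gg Gh; rewrite !dispE symDl !symDr !addrA.
  by move/eqP; rewrite -subr_eq0 addrK => /eqP.
have := E x; have := E (- x); rewrite !mulmxN.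
have symNl u v : B (- u) v = - B u v by exact: linearNl.
have symNr u v : B u (- v) = - B u v by exact: linearNr.
rewrite !symNl !symNr opprK -opprD.
set a := B _ (A h *m x); set b := _ + _ => /eqP; rewrite subr_eq0 => /eqP ab.
rewrite ab => /eqP; rewrite -mulr2n mulrn_eq0 /= => /eqP b0.
by rewrite b0.
Qed.

Lemma linA_disj g h x y : Gamma g -> Gamma h ->
  B (A g *m x) (A h *m y) + B (A g *m y) (A h *m x) = 0.
Proof.
move=> Gg Gh.
have [E _] := disp_formP (x + y) Gg Gh.
have [Ex _] := disp_formP x Gg Gh; have [Ey _] := disp_formP y Gg Gh.
by move: E; rewrite !mulmxDr !symDl !symDr Ex Ey add0r addr0.
Qed.

(** Invariance of [B] under [I + A] gives skewness up to the term [B (A x) (A y)], which is zero by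
    polarization. *)
Lemma linA_skew g x y : Gamma g -> B (A g *m x) y = - B x (A g *m y).
Proof.
move=> Gg; case: hM => /(_ g Gg) gI _ _ _ _.
have := linA_disj x y Gg Gg; rewrite [B (_ *m y) _]symC => /eqP.
rewrite -mulr2n mulrn_eq0 /= => /eqP E.
have := gI x y; rewrite /= !linE !symDl !symDr E addr0.
by rewrite -addrA => /(canRL (addKr _)); rewrite addNr => /addr0_eq <-.
Qed.

Lemma linA_comm g h : Gamma g -> Gamma h -> A g *m A h = A h *m A g.
Proof.
move=> Gg Gh; have /(congr1 val)[+ _] := hab Gg Gh.
rewrite -/(lin g) -/(lin h) !mulmxBl !mulmxBr !mul1mx !mulmx1 => ->.
by rewrite !opprB !addrA addrAC [in RHS]addrAC; congr (_ + _); rewrite addrAC.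
Qed.

Lemma linA_trl_comm g h : Gamma g -> Gamma h -> A g *m trl h = A h *m trl g.
Proof.
move=> Gg Gh; have /(congr1 val)[_ +] := hab Gg Gh.
rewrite -/(lin g) -/(lin h) -/(trl g) -/(trl h) !linE.
rewrite addrAC [RHS]addrAC [trl h + trl g]addrC.
by move/addrI.
Qed.

Lemma nondeg_eq0 (M : 'M[R]_n) : (forall x y, B x (M *m y) = 0) -> M = 0.
Proof.
move=> M0; apply/matrixP => i j.
have : M *m delta_mx j (0 : 'I_1) = 0 by apply: Bnd => y; rewrite symC.
by rewrite -colE => /matrixP /(_ i 0); rewrite !mxE.
Qed.

(** [B (A g x) (A h y)] changes sign when [x] and [y] are exchanged ([linA_disj]), yet is symmetric
    in them by skewness and commutation. *)
Lemma linA_mul g h : Gamma g -> Gamma h -> A g *m A h = 0.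
Proof.
move=> Gg Gh; apply: nondeg_eq0 => x y.
have := linA_disj x y Gg Gh; rewrite [B (A g *m y) _]symC !linA_skew // !mulmxA.
rewrite (linA_comm Gh Gg) -opprD => /eqP.
by rewrite oppr_eq0 -mulr2n mulrn_eq0 /= => /eqP.
Qed.

(** By skewness the linear part of [disp_formP] is a sum of two terms, which commutation makes equal
    ([linA_trl_comm]). *)
Lemma linA_trl g h : Gamma g -> Gamma h -> A g *m trl h = 0.
Proof.
move=> Gg Gh; apply: Bnd => x.
rewrite symC; have [_] := disp_formP x Gg Gh; rewrite [B (trl g) _]symC !linA_skew //.
rewrite -(linA_trl_comm Gg Gh) -opprD => /eqP.
by rewrite oppr_eq0 -mulr2n mulrn_eq0 /= => /eqP.
Qed.

Lemma linAM g h : Gamma g -> Gamma h -> A (g * h)%g = A g + A h.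
Proof.
move=> Gg Gh; have -> : lin (g * h)%g = lin g *m lin h by [].
have E : A g *m lin h = A g.
  by rewrite -{1}[lin h](subrK 1%:M) mulmxDr linA_mul // mulmx1 add0r.
by rewrite -{1}[lin g](subrK 1%:M) mulmxDl mul1mx E addrA.
Qed.

Lemma trlM g h : Gamma g -> Gamma h -> trl (g * h)%g = trl g + trl h.
Proof.
move=> Gg Gh; rewrite {1}/trl /= -/(trl g) -/(trl h) linE linA_trl // addr0.
exact: addrC.
Qed.

(** The mixed terms vanish by [linA_mul] and [linA_trl], so at every point the displacement is a
    homomorphism to R^n. *)
Lemma dispM g h x : Gamma g -> Gamma h -> disp (g * h)%g x = disp g x + disp h x.
Proof.
by move=> Gg Gh; rewrite !dispE trlM // linAM // mulmxDl addrACA.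
Qed.

Lemma disp1 x : disp (1%g : affine R n) x = 0.
Proof. by rewrite dispE /lin /trl /= subrr mul0mx addr0. Qed.

Lemma disp_eq0 g x : Gamma g -> disp g x = 0 -> g = 1%g.
Proof. by case: hM => _ _ free _ _ Gg /eqP; rewrite subr_eq0 => /eqP /(free _ _ Gg). Qed.

Lemma disp_div g h x : Gamma g -> Gamma h -> disp (g / h)%g x = disp g x - disp h x.
Proof.
move=> Gg Gh; apply/eqP; rewrite eq_sym subr_eq -dispM ?mulgVK //.
exact: Gamma_div.
Qed.

Lemma disp_inj g h x : Gamma g -> Gamma h -> disp g x = disp h x -> g = h.
Proof.
move=> Gg Gh E; have /(disp_eq0 (Gamma_div Gg Gh)) : disp (g / h)%g x = 0.
  by rewrite disp_div // E subrr.
by move=> E1; rewrite -[g](mulgVK h) E1 mul1g.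
Qed.

Lemma disp_locally_finite x (M : R) :
  finite_set [set g | Gamma g /\ `|disp g x| <= M].
Proof.
case: hM => _ _ _ pd _.
(* This ball contains both [x] and [act g x]; the maximum with 0 covers negative [M]. *)
have := pd _ (@compact_cV_ball R n (`|x| + Num.max M 0)).
apply: sub_finite_set => g /= [Gg gM]; split=> //.
exists (act g x); split.
  by exists x => //=; rewrite lerDl le_max lexx orbT.
rewrite /= -[act g x](subrK x) addrC; apply: le_trans (ler_normD _ _) _.
by rewrite lerD2l le_max gM.
Qed.

Lemma trl_disp g : trl g = disp g 0.
Proof. by rewrite dispE mulmx0 add0r. Qed.

(** * Bases of Gamma and their displacements *)

Definition gcomb k (gam : 'I_k -> affine R n) (m : 'I_k -> int) : affine R n :=
  \big[*%g/1%g]_(i < k) zexpg (gam i) (m i).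

Lemma zexpg_subgroup (gT : groupType) (H : set gT) (g : gT) (m : int) :
  subgroup H -> H g -> H (zexpg g m).
Proof.
move=> sH Hg; have /= sHm := group_closedM sH; have /= sHV := group_closedV sH.
have H1 : H 1%g by case: sH; rewrite inE.
have Hp p : H (g ^+ p)%g.
  elim: p => [//|p IH]; rewrite expgS.
  by have := sHm g (g ^+ p)%g; rewrite !inE; apply.
case: m => p //=; have := sHV (g ^+ p.+1)%g; rewrite !inE; exact.
Qed.

Lemma prodg_subgroup (gT : groupType) (H : set gT) k (g : 'I_k -> gT) :
  subgroup H -> (forall i, H (g i)) -> H (\big[*%g/1%g]_(i < k) g i).
Proof.
move=> sH Hg; have /= sHm := group_closedM sH.
elim/big_ind: _ => [|x y Hx Hy|//]; first by case: sH; rewrite inE.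
by have := sHm x y; rewrite !inE; apply.
Qed.

Lemma Gamma_subgroup : subgroup Gamma. Proof. by case: hM. Qed.

Lemma disp_zexpg g (m : int) x : Gamma g -> disp (zexpg g m) x = m%:~R *: disp g x.
Proof.
move=> Gg; have dp p : Gamma (g ^+ p)%g /\ disp (g ^+ p)%g x = p%:R *: disp g x.
  elim: p => [|p [Gp IH]]; first by rewrite scale0r expg0 disp1; split=> //; exact: Gamma1.
  rewrite expgS dispM //; split; first exact: GammaM.
  by rewrite IH -natr1 scalerDl scale1r addrC.
case: m => p /=; first by case: (dp p).
have [Gp E] := dp p.+1; rewrite -[(g ^- p.+1)%g]mul1g disp_div ?disp1 //; last exact: Gamma1.
by rewrite E sub0r NegzE mulrNz scaleNr.
Qed.

Lemma disp_prod k (g : 'I_k -> affine R n) x : (forall i, Gamma (g i)) ->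
  disp (\big[*%g/1%g]_(i < k) g i) x = \sum_i disp (g i) x.
Proof.
move=> Gg; suff [] : Gamma (\big[*%g/1%g]_(i < k) g i) /\
  disp (\big[*%g/1%g]_(i < k) g i) x = \sum_i disp (g i) x by [].
elim/big_ind2: _ => [|g1 x1 g2 x2 [G1 <-] [G2 <-]|//].
  by split; [exact: Gamma1|exact: disp1].
by split; [exact: GammaM|rewrite dispM].
Qed.

Lemma disp_gcomb k (gam : 'I_k -> affine R n) m x : (forall i, Gamma (gam i)) ->
  Gamma (gcomb gam m) /\ disp (gcomb gam m) x = \sum_i (m i)%:~R *: disp (gam i) x.
Proof.
move=> Gg; have Gz i : Gamma (zexpg (gam i) (m i)).
  exact: zexpg_subgroup Gamma_subgroup _.
split; first exact: prodg_subgroup Gamma_subgroup _.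
by rewrite disp_prod //; apply: eq_bigr => i _; rewrite disp_zexpg.
Qed.

(** Displacement at 0 is the translation part; it embeds Gamma as a discrete subgroup of R^n, whose
    lattice basis is pulled back. *)
Lemma Gamma_basis : exists k (gam : 'I_k -> affine R n),
  [/\ forall i, Gamma (gam i), free [tuple trl (gam i) | i < k] &
      forall g, Gamma g -> exists m, g = gcomb gam m].
Proof.
pose T := [set disp g 0 | g in Gamma].
have GT : additive_subgroup T.
  split; first by exists 1%g; [exact: Gamma1|exact: disp1].
  move=> _ _ [g Gg <-] [h Gh <-]; exists (g / h)%g; first exact: Gamma_div.
  exact: disp_div.
have FT : locally_finite T.
  move=> M; apply: sub_finite_set (finite_image (fun g => disp g 0) (disp_locally_finite 0 M)).
  by move=> _ /= [[g Gg <-] gM]; exists g.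
have [k [c [fc Tc]]] := lattice_basis GT FT.
have cG i : exists g, Gamma g /\ disp g 0 = tnth c i.
  suff : T (tnth c i) by case=> g; exists g.
  rewrite Tc; exists (fun j => (j == i)%:R).
  rewrite (bigD1 i) //= eqxx scale1r big1 ?addr0 // => j /negPf ->.
  by rewrite scale0r.
have [gam gamP] := fin_all_exists cG.
have Ggam i : Gamma (gam i) by case: (gamP i).
exists k, gam; split=> //.
  rewrite (_ : [tuple _ | i < k] = c) //; apply: eq_from_tnth => i.
  by rewrite tnth_mktuple trl_disp; case: (gamP i).
move=> g Gg; have : T (disp g 0) by exists g.
rewrite Tc => -[m gm]; exists m; have [Gm dm] := disp_gcomb m 0 Ggam.
apply: (@disp_inj _ _ 0) => //; rewrite gm dm; apply: eq_bigr => i _.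
by case: (gamP i) => _ ->.
Qed.

Section Generators.
Context {k : nat} {gam : 'I_k -> affine R n}.
Hypothesis Ggam : forall i, Gamma (gam i).
Hypothesis fgam : free [tuple trl (gam i) | i < k].
Hypothesis gamP : forall g, Gamma g -> exists m, g = gcomb gam m.

Lemma trl_free (t : 'I_k -> R) : \sum_i t i *: trl (gam i) = 0 -> forall i, t i = 0.
Proof.
move=> t0; have /freeP := fgam; apply; rewrite -[RHS]t0; apply: eq_bigr => i _.
by rewrite -tnth_nth tnth_mktuple.
Qed.

Lemma gam_inj : injective gam.
Proof.
move=> i j E; apply/(tuple_uniqP _ (free_uniq fgam)).
by rewrite !tnth_mktuple E.
Qed.

Lemma Gamma_generated : Gamma = generated (range gam).
Proof.
apply/seteqP; split=> [g /gamP[m ->] H [sH gH]|g].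
  apply: prodg_subgroup => // i; apply: zexpg_subgroup => //.
  by apply: gH; exists i.
apply; split; first exact: Gamma_subgroup.
by move=> _ [i _ <-].
Qed.

Lemma Gamma_zbasis : zbasis Gamma (range gam).
Proof.
split; [exact: hab|exact: Gamma_generated|move=> p b e binj br be i].
have bgam j : exists l, gam l = b j by case: (br j) => l _ <-; exists l.
have [s bs] := fin_all_exists bgam.
have sinj : injective s by move=> j l E; apply: binj; rewrite -!bs E.
(* The exponents [e], reindexed along [s] by the generators; injectivity of [s] leaves at most one
   term in each sum. *)
pose t j : R := \sum_(l | s l == j) (e l)%:~R.
suff : t (s i) = 0.
  rewrite /t (eq_bigl (pred1 i)) => [|l]; last by rewrite (inj_eq sinj).
  by rewrite big_pred1_eq => /eqP; rewrite intr_eq0 => /eqP.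
apply: trl_free; transitivity (disp (\big[*%g/1%g]_(i < p) zexpg (b i) (e i)) 0).
  have Gb j : Gamma (b j) by rewrite -bs.
  have := (disp_gcomb e 0 Gb).2; rewrite /gcomb => ->.
  rewrite [RHS](partition_big s predT) //=; apply: eq_bigr => j _.
  rewrite /t scaler_suml; apply: eq_bigr => l /eqP <-.
  by rewrite -bs -trl_disp.
by rewrite be disp1.
Qed.

Lemma Gamma_rank : has_rank Gamma k.
Proof.
exists (range gam); first exact: Gamma_zbasis.
have E : (range gam #= [set: 'I_k])%card.
  by apply: inj_card_eq => i j _ _; exact: gam_inj.
rewrite (card_eq_trans E) // card_eq_sym; exact: card_II.
Qed.

(* A real relation between the displacements at [x] would make the integral
   parts of its multiples infinitely many elements of [Gamma] with bounded
   displacement at [x]. *)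
Lemma disp_free x (t : 'I_k -> R) :
  \sum_i t i *: disp (gam i) x = 0 -> forall i, t i = 0.
Proof.
move=> t0 i; apply/eqP/negPn/negP => ti.
(* Rescaling by [N] makes the i-th coefficient at least 1 in absolute value, so its multiples by
   distinct [j] have distinct integral parts. *)
have [N N1] : exists N : nat, 1 <= `|N%:R * t i|.
  exists (Num.bound `|t i|^-1); rewrite normrM normr_nat -ler_pdivrMr ?normr_gt0 //.
  by rewrite mul1r ltW // archi_boundP // invr_ge0.
pose m (j : nat) l := Num.floor (j%:R * (N%:R * t l)).
pose gm j := gcomb gam (m j).
have gmG j : Gamma (gm j) by case: (disp_gcomb (m j) x Ggam).
have gm_inj : injective gm.
  move=> j j' E.
  have : \sum_l ((m j l)%:~R - (m j' l)%:~R) *: trl (gam l) = 0 :> 'cV[R]_n.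
    under eq_bigr do rewrite scalerBl trl_disp.
    rewrite sumrB -(disp_gcomb (m j) 0 Ggam).2 -(disp_gcomb (m j') 0 Ggam).2.
    by rewrite -!/(gm _) E subrr.
  move/trl_free/(_ i)/eqP; rewrite subr_eq0 eqr_int => /eqP mE.
  have : `|j%:R - j'%:R| * `|N%:R * t i| < 1.
    rewrite -normrM mulrBl ltr_norml.
    have := floor_itv (j%:R * (N%:R * t i)); have := floor_itv (j'%:R * (N%:R * t i)).
    rewrite -/(m j i) -/(m j' i) mE !intrD1 => /andP[a1 a2] /andP[b1 b2].
    apply/andP; split; last by rewrite ltrBlDr (lt_le_trans b2) // addrC lerD2l.
    by rewrite ltrBrDl (lt_le_trans _ b1) // ltrBlDr.
  move/(le_lt_trans (ler_peMr (normr_ge0 _) N1)).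
  have -> : (j%:R - j'%:R : R) = (j%:Z - j'%:Z)%:~R by rewrite rmorphB.
  rewrite -intr_norm -[1]/(1%:~R) ltr_int; lia.
apply: infinite_nat.
pose M := \sum_l `|disp (gam l) x|.
apply: sub_finite_set (finite_preimage _ (disp_locally_finite x M)); last first.
  by move=> j j' _ _; exact: gm_inj.
move=> j _ /=; split; first exact: gmG.
rewrite (disp_gcomb (m j) x Ggam).2.
(* Since the real relation vanishes at [x], only the fractional parts contribute, whence the bound
   [M] independent of [j]. *)
have -> : \sum_l (m j l)%:~R *: disp (gam l) x =
    - \sum_l (j%:R * (N%:R * t l) - (m j l)%:~R) *: disp (gam l) x.
  under [in RHS]eq_bigr do rewrite scalerBl.
  rewrite sumrB opprB; under [X in _ - X]eq_bigr do rewrite mulrA -scalerA.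
  by rewrite -scaler_sumr t0 scaler0 subr0.
rewrite normrN; apply: le_trans (ler_norm_sum _ _ _) _; apply: ler_sum => l _.
rewrite normrZ ler_piMl // ger0_norm ?subr_ge0 ?floor_le //.
by rewrite lerBlDl -intrD1 ltW // floorD1_gt.
Qed.

End Generators.

(** * The subspace U_Gamma and its dimension *)

Lemma U_of_min (V : {vspace 'cV[R]_n}) :
  (forall g x, Gamma g -> A g *m x \in V) -> (U_of Gamma <= V)%VS.
Proof.
move=> AV; apply/subvP => x /U_ofP[m [g [Gg]]]; apply/subvP/subv_sumP => i _.
by apply/subvP => _ /memv_imgP[y _ ->]; rewrite lfunE; exact: AV.
Qed.

Lemma mem_U_of g x : Gamma g -> A g *m x \in U_of Gamma.
Proof.
move=> Gg; apply/U_ofP; exists 1%N, (fun=> g); split=> //.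
rewrite big_ord1; apply/memv_imgP; exists x; first exact: memvf.
by rewrite lfunE.
Qed.

(** By skewness the kernel of [A g] is the orthogonal of its image. *)
Lemma linA_ortho g y : Gamma g -> y \in orthov B (U_of Gamma) -> A g *m y = 0.
Proof.
move=> Gg /mem_orthovP yU; apply: Bnd => z.
by rewrite linA_skew // yU ?oppr0 // mem_U_of.
Qed.

(** By skewness, [B (A g x) (A h y)] reduces to a product [A g *m A h], which is zero. *)
Lemma U_of_isotropic : (U_of Gamma <= orthov B (U_of Gamma))%VS.
Proof.
apply: U_of_min => g x Gg; rewrite memvE orthov_sym; apply: U_of_min => h y Gh.
by rewrite mem_orthov1 linA_skew // mulmxA linA_mul // mul0mx linear0r oppr0.
Qed.

Lemma trl_ortho g : Gamma g -> trl g \in orthov B (U_of Gamma).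
Proof.
move=> Gg; rewrite memvE orthov_sym; apply: U_of_min => h y Gh.
by rewrite mem_orthov1 linA_skew // linA_trl // linear0r oppr0.
Qed.

Lemma linA_alt g x : Gamma g -> B (A g *m x) x = 0.
Proof.
move=> Gg; have := linA_skew x x Gg; rewrite [B x _]symC => /eqP.
by rewrite -addr_eq0 -mulr2n mulrn_eq0 /= => /eqP.
Qed.

Lemma linA_line_eq0 g a : Gamma g -> (forall x, A g *m x \in <[a]>%VS) -> A g = 0.
Proof.
move=> Gg Aa; apply: nondeg_eq0 => x y.
have [a0|a0] := eqVneq a 0.
  by have /vlineP[c ->] := Aa y; rewrite a0 scaler0 linear0r.
rewrite (skew_rank_neq1 Bnd (A := mulmx (A g)) _ a0 Aa) ?linear0r // => z.
exact: linA_alt.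
Qed.

Lemma subv_vpick (V : {vspace 'cV[R]_n}) : (\dim V <= 1)%N -> (V <= <[vpick V]>)%VS.
Proof.
move=> dV; have [->|V0] := eqVneq V 0%VS; first exact: sub0v.
have ple : (<[vpick V]> <= V)%VS by exact: memv_pick.
by have := dimv_leqif_sup ple => -[_ <-]; rewrite eqn_leq (dimvS ple) dim_vline vpick0 V0.
Qed.

Lemma dim_U_of_le1_translations : (\dim (U_of Gamma) <= 1)%N -> pure_translations Gamma.
Proof.
move=> /subv_vpick UE g Gg.
apply/eqP; rewrite -subr_eq0; apply/eqP.
apply: (@linA_line_eq0 _ (vpick (U_of Gamma))) => // x.
by apply: (subvP UE); exact: mem_U_of.
Qed.

Lemma dim_U_of_neq3 : n = 6%N -> \dim (U_of Gamma) <> 3%N.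
Proof.
move=> n6 dU; set U := U_of Gamma in dU.
(* An isotropic subspace of half the dimension is its own orthogonal. *)
have UE : orthov B U = U.
  apply/esym/eqP; rewrite eqEdim U_of_isotropic /=.
  have dV : \dim {: 'cV[R]_n} = 6%N by rewrite dimvf /dim /= muln1.
  have := dim_orthov Bnd U; rewrite dV dU; lia.
have [[g Gg Ag0]|noG] := pselect (exists2 g, Gamma g & A g != 0); last first.
  suff : (U <= 0)%VS by rewrite subv0 => /eqP U0; move: dU; rewrite U0 dimv0.
  apply: U_of_min => g x Gg; have [->|Ag0] := eqVneq (A g) 0.
    by rewrite mul0mx mem0v.
  by case: noG; exists g.
have memI x : A g *m x \in imA g.
  by apply/memv_imgP; exists x; rewrite ?memvf // lfunE.
have IU : (imA g <= U)%VS.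
  by apply/subvP => _ /memv_imgP[y _ ->]; rewrite lfunE; exact: mem_U_of.
have trlU h : Gamma h -> trl h \in U by move=> Gh; rewrite -UE trl_ortho.
(* If [trl g = A g y], then [- y] is a fixed point of [g]. *)
have vNI : trl g \notin imA g.
  apply: contra Ag0 => /memv_imgP[y _]; rewrite lfunE /= => vE.
  have /(disp_eq0 Gg) -> : disp g (- y) = 0 by rewrite dispE vE mulmxN addNr.
  by rewrite /lin /= subrr.
have dI2 : (\dim (imA g) <= 2)%N.
  rewrite -ltnS -dU ltn_neqAle dimvS // andbT; apply: contra vNI => /eqP dIU.
  have /eqP -> : imA g == U by rewrite eqEdim IU dIU leqnn.
  exact: trlU.
(* Rank at most 1 is excluded by skewness, rank 3 by [trl g] lying in [U] outside the image. *)
have dI : \dim (imA g) = 2%N.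
  apply/eqP; rewrite eqn_leq dI2 /= ltnNge; apply: contra Ag0 => dI1.
  apply/eqP; apply: (@linA_line_eq0 _ (vpick (imA g))) => // x.
  by apply: (subvP (subv_vpick dI1)).
have UI : (U = imA g + <[trl g]>)%VS.
  apply/esym/eqP; rewrite eqEdim subv_add IU -memvE trlU //= dU.
  have vI0 : (imA g :&: <[trl g]> = 0)%VS.
    apply/eqP; rewrite -subv0; apply/subvP => y /memv_capP[yI /vlineP[a yE]].
    have [a0|a0] := eqVneq a 0; first by rewrite yE a0 scale0r mem0v.
    by move: vNI; rewrite -(scalerK a0 (trl g)) -yE memvZ.
  rewrite dimv_disjoint_sum // dI dim_vline.
  by rewrite (_ : trl g != 0) //; apply: contraNneq vNI => ->; rewrite mem0v.
suff : (U <= imA g)%VS by move/dimvS; rewrite dU dI.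
apply: U_of_min => h x Gh.
(* [L - I] sends [trl h] to [A h x]. Writing [trl h = A g y + c trl g] and using that [L] commutes
   with [A g] puts [A h x] into the image of [A g]. *)
have [L [_ LA Lt]] := centralizer_transitive x.
have -> : A h *m x = L *m trl h - trl h by rewrite Lt // addrAC subrr add0r.
have /memv_addP[_ /memv_imgP[y _ ->] [_ /vlineP[c ->] ->]] :
  trl h \in (imA g + <[trl g]>)%VS by rewrite -UI trlU.
rewrite lfunE /= mulmxDr mulmxA LA // -mulmxA -scalemxAr Lt // scalerDr.
rewrite opprD addrACA [c *: _ + _]addrC addrK.
by rewrite memvD ?memvB ?memvZ.
Qed.

End Group.

(** * Normal form in a Witt basis *)

Lemma mul_col_family (R : realType) n k (t : k.-tuple 'cV[R]_n) (a : 'cV[R]_k) :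
  col_family t *m a = \sum_j a j 0 *: tnth t j.
Proof.
apply/colP => i; rewrite !mxE summxE; apply: eq_bigr => j _.
by rewrite !mxE mulrC.
Qed.

Lemma col_col_family (R : realType) n k (t : k.-tuple 'cV[R]_n) j :
  col j (col_family t) = tnth t j.
Proof. by apply/colP => i; rewrite !mxE. Qed.

Lemma col_family_inj (R : realType) n k p (t : k.-tuple 'cV[R]_n) (M : 'M[R]_(k, p)) :
  free t -> col_family t *m M = 0 -> M = 0.
Proof.
move=> /freeP ft M0; apply/matrixP => i j; rewrite [RHS]mxE.
have := congr1 (col j) M0; rewrite col0 colE -mulmxA -colE mul_col_family => E.
apply: (ft (fun i => M i j)); rewrite -[RHS]E; apply: eq_bigr => l _.
by rewrite mxE -tnth_nth.
Qed.

(** Hence [skew2 c] is invertible for nonzero [c], with inverse [- skew2 c^-1]. *)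
Lemma mul_skew2 (R : realType) (c d : R) : skew2 c *m skew2 d = (- (c * d))%:M.
Proof.
apply/matrixP => i j; rewrite !mxE !big_ord_recl big_ord0 !mxE.
by case: i => [[|[|//]] ?]; case: j => [[|[|//]] ?];
  rewrite /= ?mul0r ?mulr0 ?add0r ?addr0 ?mulrN ?mulNr ?mulr1n ?mulr0n.
Qed.

Lemma sum_skew2 (R : realType) k (t c : 'I_k -> R) :
  \sum_i t i *: skew2 (c i) = skew2 (\sum_i t i * c i).
Proof.
apply/matrixP => i j; rewrite summxE !mxE.
under eq_bigr do rewrite !mxE.
case: eqP => _; first by rewrite big1 // => l _; rewrite mulr0.
case: ifP => _ //; rewrite -sumrN; apply: eq_bigr => l _; exact: mulrN.
Qed.

Section WittForm.
Context {R : realType} {n : nat} {B : {symmetric 'cV[R]_n}}.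
Context {Gamma : set (affine R n)}.
Hypothesis Bnd : forall x, (forall y, B x y = 0) -> x = 0.
Hypothesis hM : homogeneous_flat B Gamma.
Hypothesis hab : abelian_subgroup Gamma.
Context {m : nat} {u : 2.-tuple 'cV[R]_n} {w : m.-tuple 'cV[R]_n}.
Context {u' : 2.-tuple 'cV[R]_n}.
Hypothesis wb : witt_basis B (U_of Gamma) u w u'.

Local Notation A g := (lin g - 1%:M).

Lemma witt_dual y : y \in U_of Gamma -> y = \sum_i B y (tnth u' i) *: tnth u i.
Proof.
case: wb => -[_ bu] _ _ _ uu' yU.
have yE : y = \sum_i coord u i y *: tnth u i.
  by rewrite {1}(coord_basis bu yU); apply: eq_bigr => i _; rewrite -tnth_nth.
rewrite {1}yE; apply: eq_bigr => i _; congr (_ *: _); rewrite [in RHS]yE sym_suml.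
rewrite (bigD1 i) //= symZl uu' eqxx mulr1 big1 ?addr0 // => j ji.
by rewrite symZl uu' (negPf ji) mulr0.
Qed.

Lemma linA_witt_u g : Gamma g -> A g *m col_family u = 0.
Proof.
move=> Gg; case: wb => -[_ bu] _ _ _ _.
apply/matrixP => i j; have : A g *m tnth u j = 0.
  apply: (linA_ortho Bnd hM Gg); apply: (subvP (U_of_isotropic Bnd hM hab)).
  by apply: basis_mem bu _; exact: mem_tnth.
rewrite -(col_col_family u) colE mulmxA -colE => /matrixP /(_ i 0).
by rewrite !mxE.
Qed.

Lemma linA_witt_w g : Gamma g -> A g *m col_family w = 0.
Proof.
move=> Gg; case: wb => _ _ [UW _] _ _.
apply/matrixP => i j; have : A g *m tnth w j = 0.
  apply: (linA_ortho Bnd hM Gg); rewrite UW; apply: (subvP (addvSr _ _)).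
  by rewrite memv_span ?mem_tnth.
rewrite -(col_col_family w) colE mulmxA -colE => /matrixP /(_ i 0).
by rewrite !mxE.
Qed.

(** Pairing with [u'_i] reads off the i-th coordinate in [U], so this is the upper right entry of
    the block of [A g] from [U'] to [U]. *)
Definition witt_coef g : R := B (A g *m tnth u' ord_max) (tnth u' ord0).

(** The entries of the block are [B (A g u'_j) u'_l]; as [A g] is skew, this 2 by 2 matrix is skew
    and determined by one entry. *)
Lemma linA_witt_u' g : Gamma g ->
  A g *m col_family u' = col_family u *m skew2 (witt_coef g).
Proof.
move=> Gg; apply/matrixP => i j.
suff : A g *m tnth u' j = col_family u *m col j (skew2 (witt_coef g)).
  rewrite -(col_col_family u') !colE !mulmxA -!colE => /matrixP /(_ i 0).
  by rewrite !mxE.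
rewrite mul_col_family [LHS]witt_dual; last exact: mem_U_of.
apply: eq_bigr => l _; congr (_ *: _); rewrite !mxE.
have alt x : B (A g *m x) x = 0 by exact: (linA_alt hM).
have ord2 (p : 'I_2) : p = ord0 \/ p = ord_max.
  by case: p => [[|[|//]] hp]; [left|right]; exact: val_inj.
case: (ord2 l) (ord2 j) => -> [] -> //=; rewrite ?alt // (linA_skew hM) // symC.
by [].
Qed.

(** Translation parts are orthogonal to U_Gamma, hence lie in [U + W] and have no component along
    [u']. *)
Lemma trl_witt g : Gamma g -> exists a b,
  trl g = col_family u *m a + col_family w *m b.
Proof.
move=> Gg; case: wb => -[_ bu] [bw _] [UW _] _ _.
have := trl_ortho Bnd hM hab Gg; rewrite UW.
move=> /memv_addP[x /(coord_basis bu) xE [y /(coord_basis bw) yE ->]].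
exists (\col_i coord u i x), (\col_i coord w i y).
rewrite !mul_col_family {1}xE {1}yE; congr (_ + _); apply: eq_bigr => i _;
  by rewrite mxE -tnth_nth.
Qed.

Lemma unipotent_form_witt g a b : Gamma g ->
  trl g = col_family u *m a + col_family w *m b ->
  unipotent_form (basis_mx u w u') g (skew2 (witt_coef g)) a b.
Proof.
move=> Gg gE; split; rewrite /basis_mx; last first.
  by rewrite !mul_row_col mulmx0 addr0.
rewrite -[lin g](subrK 1%:M) mulmxDl mul1mx !mul_mx_row linA_witt_u // linA_witt_w //.
rewrite linA_witt_u' // mul_row_block -scalar_mx_block !mulmx1 mulmx0 addr0.
by rewrite mul_row_col mulmx0 addr0 !add_row_mx !add0r.
Qed.

Lemma eq0_on_witt (S : 'M[R]_n) : S *m col_family u = 0 -> S *m col_family w = 0 ->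
  S *m col_family u' = 0 -> S = 0.
Proof.
have tS k (t : k.-tuple 'cV[R]_n) : S *m col_family t = 0 ->
    {subset t <= lker (linfun (mulmx S : 'cV[R]_n -> 'cV[R]_n))}.
  move=> St _ /tnthP[i ->]; rewrite memv_ker lfunE /=.
  by rewrite -(col_col_family t) colE mulmxA St mul0mx.
move=> /tS Su /tS Sw /tS Su'; case: wb => -[/span_basis bf _] _ _ _ _.
have Sf : (fullv <= lker (linfun (mulmx S : 'cV[R]_n -> 'cV[R]_n)))%VS.
  rewrite -bf; apply/span_subvP => x; rewrite !mem_cat.
  by case/or3P => [/Su|/Sw|/Su'].
apply/matrixP => i j.
have := subvP Sf (delta_mx j 0) (memvf _).
by rewrite memv_ker lfunE /= -colE => /eqP/matrixP/(_ i 0); rewrite !mxE.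
Qed.

End WittForm.

(** * Linear relations between the generators in a Witt basis *)

Section GeneratorsForm.
Context {R : realType} {n : nat} {B : {symmetric 'cV[R]_n}}.
Context {Gamma : set (affine R n)}.
Hypothesis Bnd : forall x, (forall y, B x y = 0) -> x = 0.
Hypothesis hM : homogeneous_flat B Gamma.
Hypothesis hab : abelian_subgroup Gamma.
Context {k : nat} {gam : 'I_k -> affine R n}.
Hypothesis Ggam : forall i, Gamma (gam i).
Hypothesis fgam : free [tuple trl (gam i) | i < k].

Lemma generators_in_form_witt (u w u' : 2.-tuple 'cV[R]_n) :
  witt_basis B (U_of Gamma) u w u' -> generators_in_form gam (basis_mx u w u').
Proof.
move=> wb.
pose c i : R := @witt_coef R n B u' (gam i).
have [a ab] := fin_all_exists (fun i => trl_witt Bnd hM hab wb (Ggam i)).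
have [b trlE] := fin_all_exists ab.
exists c, a, b; split=> [i|t].
  exact: (unipotent_form_witt Bnd hM hab wb (Ggam i) (trlE i)).
set S := \sum_i t i *: (lin (gam i) - 1%:M).
have Su : S *m col_family u = 0.
  rewrite mulmx_suml big1 // => i _.
  by rewrite -scalemxAl (linA_witt_u Bnd hM hab wb (Ggam i)) scaler0.
have Sw : S *m col_family w = 0.
  rewrite mulmx_suml big1 // => i _.
  by rewrite -scalemxAl (linA_witt_w Bnd hM wb (Ggam i)) scaler0.
have Su' : S *m col_family u' = col_family u *m (\sum_i t i *: skew2 (c i)).
  rewrite mulmx_suml mulmx_sumr; apply: eq_bigr => i _.
  by rewrite -scalemxAl -scalemxAr (linA_witt_u' hM wb (Ggam i)).
have fu : free u by case: wb => -[_ /basis_free].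
split; last first.
  split=> [C0|S0].
    by apply: (eq0_on_witt wb) => //; rewrite Su' C0 mulmx0.
  by apply: (col_family_inj fu); rewrite -Su' S0 mul0mx.
move=> b0; rewrite sum_skew2; set cl := \sum_i _.
have [->|cl0] := eqVneq cl 0; first by apply/matrixP => i j; rewrite !mxE oppr0 !if_same.
pose al := \sum_i t i *: a i.
(* [y] solves [skew2 cl *m y = - al]. At the point with [u']-coordinates [y], the combined
   displacement has zero [w]-part by [b0] and zero [u]-part by this choice, so [disp_free] forces
   all [t i] to vanish. *)
pose y := skew2 cl^-1 *m al.
have yE : skew2 cl *m y = - al.
  by rewrite mulmxA mul_skew2 divff // raddfN mulNmx mul1mx.
have t0 : forall i, t i = 0.
  apply: (disp_free Bnd hM hab Ggam fgam (x := col_family u' *m y)).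
  under eq_bigr do rewrite dispE scalerDr scalemxAl.
  rewrite big_split /= -mulmx_suml -/S mulmxA Su' sum_skew2 -/cl -mulmxA yE.
  rewrite [X in _ + X](_ : _ = col_family u *m al) ?mulmxN ?addNr //.
  under eq_bigr do rewrite trlE scalerDr !scalemxAr.
  by rewrite big_split /= -!mulmx_sumr b0 mulmx0 addr0.
case/eqP: cl0; rewrite /cl big1 // => i _.
by rewrite t0 mul0r.
Qed.

End GeneratorsForm.

(** * The classification in dimension six *)

Theorem proposition4p12 (R : realType) (s : nat) (hs : (s <= 6 - s)%N)
    (B : {symmetric 'cV[R]_6}) (hB : has_signature B (6 - s) s)
    (Gamma : set (affine R 6)) (hM : homogeneous_flat B Gamma)
    (hab : abelian_subgroup Gamma) :
  [/\ free_abelian Gamma,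
      s = 0%N \/ s = 1%N -> pure_translations Gamma,
      s = 2%N -> groups_42 B Gamma &
      s = 3%N ->
        ((\dim (U_of Gamma) < 3)%N -> groups_42 B Gamma) /\
        \dim (U_of Gamma) <> 3%N].
Proof.
have Bnd := has_signature_nondegenerate hB.
have [k [gam [Ggam fgam gamP]]] := Gamma_basis Bnd hM hab.
have UU := U_of_isotropic Bnd hM hab.
have dU := has_signature_isotropic hB UU.
have g42 : (\dim (U_of Gamma) < 3)%N -> groups_42 B Gamma.
  rewrite ltnS => dU2.
  have [dU1|dU1] := leqP (\dim (U_of Gamma)) 1.
    by left; exact: (dim_U_of_le1_translations Bnd hM).
  have {dU1}dUE : \dim (U_of Gamma) = 2%N by apply/eqP; rewrite eqn_leq dU2.
  have [pt|npt] := pselect (pure_translations Gamma); [by left|right].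
  split=> //.
  - have /existsNP[g /not_implyP[Gg gl]] := npt; by exists g.
  - exists k, gam; split=> //.
    + exact: (Gamma_generated hM).
    + exact: witt_basis_exists.
    + by move=> u w u'; exact: generators_in_form_witt.
  - exists k; last exact: (Gamma_rank Bnd hM hab Ggam fgam gamP).
    (* The independent translation parts lie in the orthogonal of U_Gamma, of dimension 6 - 2 =
       4. *)
    have : (<<[tuple trl (gam i) | i < k]>> <= orthov B (U_of Gamma))%VS.
      apply/span_subvP => x /tnthP[i ->]; rewrite tnth_mktuple.
      exact: (trl_ortho Bnd hM hab).
    move/dimvS; rewrite (eqnP fgam) size_tuple => /leq_trans; apply.
    have := dim_orthov Bnd (U_of Gamma); rewrite dUE dimvf /dim /=; lia.
split.
- by exists (range gam); exact: (Gamma_zbasis Bnd hM hab Ggam fgam gamP).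
(* An isotropic subspace has dimension at most [s], here at most 1. *)
- by move=> s01; apply: (dim_U_of_le1_translations Bnd hM); case: s01 dU => ->; lia.
- by move=> s2; apply: g42; move: dU; rewrite s2.
- by move=> s3; split=> //; exact: (dim_U_of_neq3 Bnd hM hab).
Qed.
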